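(* Let $a_1,d$ be positive integers and let $n>a_1+d$. For every integer $l>0$, the number of primitive periodic orbits of length $l$ on the directed circulant graph $C_n^+(a_1,a_1+d)$ is \[ PO(n,l,a_1,d)=\frac{n}{l}\sum_{m=\lceil a_1 l/n\rceil}^{\lfloor (d+a_1)l/n\rfloor}\ \sum_{\omega\mid m,\ \omega\mid l}\mu(\omega)\binom{l/\omega}{\frac{mn-a_1l}{\omega d}}, \] where the inner sum runs over positive integers $\omega$ dividing both $m$ and $l$.
   Context: $C_n^+(a_1,a_1+d)$ is the directed graph with vertex set $\{0,1,\dots,n-1\}$ (identified with $\mathbb{Z}/n\mathbb{Z}$) whose bonds (directed edges) are $(v, v+a_1 \bmod n)$ and $(v, v+a_1+d \bmod n)$ for every vertex $v$. A walk of length $l$ is a sequence of vertices $v_0,v_1,\dots,v_l$ with each $(v_i,v_{i+1})$ a bond; a circuit is a walk of positive length with $v_l=v_0$. A periodic orbit is an equivalence class of circuits under cyclic rotation; its length is the length of any circuit in it. A circuit (periodic orbit) is primitive if it is not a shorter circuit (periodic orbit) repeated several times. $\mu$ is the Möbius function: $\mu(1)=1$, $\mu(\omega)=0$ if $\omega$ is divisible by the square of a prime, and $\mu(\omega)=(-1)^k$ if $\omega$ is a product of $k$ distinct primes. Convention: a binomial coefficient $\binom{a}{b}$ is taken to be $0$ unless $a,b$ are integers with $0\le b\le a$ (in particular it is $0$ when the lower index is not an integer). *)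

(* Defs.v *)
From mathcomp Require Export all_boot all_order all_algebra.
Set Implicit Arguments.
Unset Strict Implicit.
Unset Printing Implicit Defensive.
Import Order.TTheory GRing.Theory Num.Theory.
Local Open Scope ring_scope.

Definition circulant_bond (n a1 d : nat) : rel 'I_n :=
  fun v w => ((w : nat) == (v + a1) %% n)%N || ((w : nat) == (v + a1 + d) %% n)%N.

Section PeriodicOrbits.
Variables (V : finType) (e : rel V).

(* The circuit v_0, ..., v_(l-1), v_l = v_0 is represented by the sequence
   v_0, ..., v_(l-1) of length l; [cycle] includes the closing step
   (v_(l-1), v_0). *)
Definition circuit (c : seq V) : bool := (0 < size c)%N && cycle e c.

Definition rotation_equiv (l : nat) : rel (l.-tuple V) :=
  fun b c => [exists i : 'I_l, rot i b == c :> seq V].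

(* The bound r <= l on the number of repetitions loses nothing, since a circuit
   has positive length; see [primitive_circuitP]. *)
Definition primitive_circuit (l : nat) (c : l.-tuple V) : bool :=
  circuit c &&
  [forall k : 'I_l, forall b : k.-tuple V, forall r : 'I_l.+1,
     circuit b ==> (tval c != flatten (nseq r (tval b)))].

Definition periodic_orbits (l : nat) : {set {set l.-tuple V}} :=
  equivalence_partition (@rotation_equiv l) [set c : l.-tuple V | circuit c].

Definition primitive_periodic_orbits (l : nat) : {set {set l.-tuple V}} :=
  [set O in periodic_orbits l | [forall c in O, primitive_circuit c]].

Lemma primitive_circuitP (l : nat) (c : l.-tuple V) :
  reflect (circuit c /\
           ~ exists (b : seq V) (r : nat),
               [/\ circuit b, (size b < l)%N & tval c = flatten (nseq r b)])
          (primitive_circuit c).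
Proof.
apply: (iffP andP) => -[cc h]; split=> //.
  case=> b [r [cb sb ce]].
  have b0 : (0 < size b)%N by case/andP: cb.
  have rl : (r < l.+1)%N.
    have : (size (flatten (nseq r b)) = l) by rewrite -ce size_tuple.
    rewrite size_flatten /shape map_nseq sumn_nseq => hl.
    by rewrite ltnS -hl leq_pmull.
  move/forallP: h => /(_ (Ordinal sb)) /forallP /(_ (in_tuple b)).
  by move/forallP => /(_ (Ordinal rl)) /=; rewrite cb -ce eqxx.
apply/forallP=> k; apply/forallP=> b; apply/forallP=> r; apply/implyP=> cb.
apply/eqP=> ce; apply: h; exists b, r; split=> //.
by rewrite size_tuple.
Qed.

Lemma rotation_equivP (l : nat) :
  {in [set c : l.-tuple V | circuit c] & &, equivalence_rel (@rotation_equiv l)}.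
Proof.
move=> x y z; rewrite inE => /andP[x0 _] _ _.
have l0 : (0 < l)%N by rewrite -(size_tuple x).
have rotE (u v : l.-tuple V) :
    reflect (exists i, rot i u = v :> seq V) (rotation_equiv u v).
  apply: (iffP existsP) => [[i /eqP h]|[i h]]; first by exists i.
  have [il|il] := ltnP i l; first by exists (Ordinal il); apply/eqP.
  exists (Ordinal l0); apply/eqP; rewrite /= rot0 -h rot_oversize //.
  by rewrite size_tuple.
have rsym (u v : l.-tuple V) : rotation_equiv u v -> rotation_equiv v u.
  case/rotE=> i h; apply/rotE; exists (size u - i)%N.
  by have := rotK i (tval u); rewrite /rotr size_rot h.
have rtrans (u v w : l.-tuple V) :
    rotation_equiv u v -> rotation_equiv v w -> rotation_equiv u w.
  case/rotE=> i hi; case/rotE=> j hj; apply/rotE.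
  have [il|il] := leqP i (size u); last first.
    by exists j; rewrite -hj -hi (rot_oversize (ltnW il)).
  have [jl|jl] := leqP j (size u); last first.
    by exists i; rewrite -hj hi rot_oversize // size_tuple -(size_tuple u) ltnW.
  rewrite -hj -hi rot_add_mod //.
  by eexists.
split; first by apply/rotE; exists 0%N; rewrite rot0.
move=> xy; apply/idP/idP; last exact: rtrans.
exact: rtrans (rsym _ _ xy).
Qed.

End PeriodicOrbits.

Definition moebius (w : nat) : int :=
  if has (fun p => p ^ 2 %| w)%N (primes w) then 0
  else (-1) ^+ size (primes w).

(* ['C(a, b)] is already 0 for natural numbers b > a. *)
Definition binomial_rat (a b : rat) : nat :=
  if (a \is a Num.nat) && (b \is a Num.nat)
  then 'C(Num.truncn a, Num.truncn b) else 0%N.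

(* Main.v *)
(** The [l] rotations of a primitive circuit of length [l] are distinct, so the
    primitive orbits are counted by the primitive circuits divided by [l].  A
    circuit [c] of length [l] has a fundamental period [t] dividing [l], and it
    is fixed by the rotation by [l / w] iff [w] divides [l / t]; since the sum of
    the Moebius function over the divisors of [l / t] is 1 or 0 according to
    whether [t = l], the primitive circuits number
    [\sum_(w %| l) mu(w) N(l / w)], where [N(k)] counts circuits of length [k]
    (those of length [l] fixed by the rotation by [k]).  A circuit of length [k]
    is a starting vertex with a choice of [j] long steps among [k] such that
    [n] divides [a1 k + d j]; the quotient is [m / w] in the final formula. *)
Require Import Defs.
From mathcomp Require Import all_boot all_order all_algebra.
From mathcomp Require Import zify.
Import Order.TTheory GRing.Theory Num.Theory.
Local Open Scope ring_scope.

Set Implicit Arguments.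
Unset Strict Implicit.
Unset Printing Implicit Defensive.

(** * Divisor sums of the Möbius function *)

Lemma moebius_mul_prime_dvd p u : prime p -> (0 < u)%N -> (p %| u)%N ->
  moebius (p * u) = 0.
Proof.
move=> pp u0 pu; rewrite /moebius ifT //; apply/hasP; exists p.
  by rewrite primesM ?(prime_gt0 pp) // (primes_prime pp) inE eqxx.
by rewrite expnS expn1 dvdn_mul.
Qed.

Lemma moebius_mul_prime p u : prime p -> (0 < u)%N -> ~~ (p %| u)%N ->
  moebius (p * u) = - moebius u.
Proof.
move=> pp u0 pu.
have pNu : p \notin primes u by rewrite mem_primes (negPf pu) !andbF.
have Ep : perm_eq (primes (p * u)) (p :: primes u).
  apply: uniq_perm; rewrite /= ?primes_uniq ?pNu // => q.
  by rewrite primesM ?(prime_gt0 pp) // (primes_prime pp) !inE.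
rewrite /moebius (perm_size Ep) /= exprS mulN1r.
have -> : has (fun q => q ^ 2 %| p * u)%N (primes (p * u)) =
          has (fun q => q ^ 2 %| u)%N (primes u).
  (* The head [p] contributes no square because [p] does not divide [u]; every other prime [q]
     differs from [p], so [q ^ 2] is prime to [p]. *)
  rewrite (perm_has _ Ep) /= expnS expn1 dvdn_pmul2l ?prime_gt0 // (negPf pu) /=.
  apply: eq_in_has => q qu; rewrite Gauss_dvdr // coprimeXl //.
  move: (qu); rewrite mem_primes => /andP[pq _].
  rewrite prime_coprime // dvdn_prime2 //; apply: contra pNu => /eqP <- //.
by case: ifP; rewrite ?oppr0.
Qed.

(* For a prime [p] dividing [k], the terms [w] and [p * w] with [w] prime to
   [p] cancel. *)
Lemma sum_moebius N k : (0 < k <= N)%N ->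
  \sum_(w < N.+1 | (w %| k)%N) moebius w = (k == 1)%N%:R.
Proof.
case/andP=> k0 kN.
have [k1|k1] := eqVneq k 1%N.
  rewrite {}k1 in kN *; case: N kN => // N _.
  rewrite (bigD1 (inord 1 : 'I_N.+2)) /= ?inordK // big1 ?addr0 //.
  move=> i; rewrite dvdn1 => /andP[/eqP i1 /eqP []]; apply/val_inj.
  by rewrite /= inordK.
set p := pdiv k; have pp : prime p by rewrite pdiv_prime //; lia.
have pk : (p %| k)%N := pdiv_dvd k.
have p0 := prime_gt0 pp.
rewrite (bigID (fun w : 'I_N.+1 => p %| w)%N) /=.
rewrite (reindex_onto (fun u : 'I_N.+1 => inord (p * u) : 'I_N.+1)
          (fun w : 'I_N.+1 => inord (w %/ p))) /=; last first.
  move=> w /andP[wk pw]; apply/val_inj => /=.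
  have wp : (w %/ p < N.+1)%N by apply: leq_ltn_trans (ltn_ord w); apply: leq_div.
  by rewrite (inordK wp) mulnC divnK // inordK.
rewrite (bigID (fun w : 'I_N.+1 => p %| w)%N) /= big1 ?add0r; last first.
  move=> u; have [uN|uN] := ltnP (p * u) N.+1; last first.
    (* Out of range, [inord] returns 0, which does not divide [k], so such an index is excluded from
       the sum. *)
    by rewrite /inord /insubd insubN -?leqNgt //= dvd0n; case: eqP; lia.
  rewrite (inordK uN) => /andP[/andP[/andP[uk _] _] pu].
  rewrite moebius_mul_prime_dvd //.
  by move: (dvdn_gt0 k0 uk); rewrite muln_gt0 => /andP[].
rewrite (eq_bigl (fun u : 'I_N.+1 => (u %| k) && ~~ (p %| u))%N); last first.
  move=> u; have [pu|pu] := boolP (p %| u)%N; rewrite ?andbF ?andbT //.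
  have [uN|uN] := ltnP (p * u) N.+1.
    rewrite (inordK uN) dvdn_mulr // mulKn // inord_val eqxx !andbT.
    by rewrite Gauss_dvd ?prime_coprime // pk.
  rewrite /inord /insubd insubN -?leqNgt //= dvd0n.
  have -> : (k == 0)%N = false by lia.
  rewrite /=; apply/esym/negbTE/negP => uk.
  have := dvdn_leq k0 (_ : (p * u %| k)%N); rewrite Gauss_dvd ?prime_coprime //.
  by rewrite pk uk => /(_ isT); lia.
rewrite -big_split big1 //= => u /andP[uk pu].
have uN : (p * u < N.+1)%N.
  by rewrite ltnS (leq_trans _ kN) // dvdn_leq // Gauss_dvd ?prime_coprime // pk.
by rewrite (inordK uN) moebius_mul_prime ?addNr // (dvdn_gt0 k0 uk).
Qed.

(** * Periods of cyclic sequences *)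

Section Cyclic.
Variables (V : finType) (x0 : V).
Implicit Types (s b : seq V) (e : rel V).

(* The periodic extension of [s] to [nat], on which rotations act as shifts. *)
Definition cyc s (i : nat) : V := nth x0 s (i %% size s).

Definition periodic s (k : nat) : Prop := forall i, cyc s (i + k) = cyc s i.

Lemma cyc_small s i : (i < size s)%N -> cyc s i = nth x0 s i.
Proof. by move=> si; rewrite /cyc modn_small. Qed.

Lemma cyc_inj s t : size s = size t -> cyc s =1 cyc t -> s = t.
Proof.
move=> est est'; apply: (@eq_from_nth _ x0) => // i si.
by rewrite -!cyc_small -?est.
Qed.

Lemma periodic_size s : periodic s (size s).
Proof. by move=> i; rewrite /cyc modnDr. Qed.

Lemma periodicD s j k : periodic s j -> periodic s k -> periodic s (j + k).
Proof. by move=> pj pk i; rewrite addnA pk pj. Qed.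

Lemma periodicB s j k : periodic s j -> periodic s (k + j) -> periodic s k.
Proof. by move=> pj pk i; rewrite -pj -addnA pk. Qed.

Lemma periodicM s j k : periodic s j -> periodic s (k * j).
Proof.
move=> pj; elim: k => [|k IHk]; first by move=> i; rewrite mul0n addn0.
by rewrite mulSn; apply: periodicD.
Qed.

Lemma periodic_mod s j k : periodic s j -> periodic s k -> periodic s (k %% j).
Proof.
move=> pj pk; apply: (@periodicB _ (k %/ j * j)); first exact: periodicM.
by rewrite addnC -divn_eq.
Qed.

Lemma cyc_mod s k i : periodic s k -> cyc s (i %% k) = cyc s i.
Proof. by move=> pk; rewrite {2}(divn_eq i k) addnC periodicM. Qed.

Lemma cyc_rot s k i : (k <= size s)%N -> cyc (rot k s) i = cyc s (i + k).
Proof.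
move=> ks; have [/size0nil->|s0] := posnP (size s); first by rewrite /cyc !nth_nil.
rewrite /cyc size_rot -(modnDml i k); move: (i %% _)%N (ltn_pmod i s0) => j js.
rewrite /rot nth_cat size_drop nth_drop; case: ltnP => h.
  by rewrite addnC modn_small //; lia.
rewrite nth_take; last by lia.
congr nth; have -> : (j + k = j - (size s - k) + size s)%N by lia.
by rewrite modnDr modn_small //; lia.
Qed.

Lemma rot_periodicP s k : (k <= size s)%N ->
  reflect (periodic s k) (rot k s == s).
Proof.
move=> ks; apply: (iffP eqP) => [rk i|pk]; first by rewrite -cyc_rot // rk.
by apply: cyc_inj => [|i]; rewrite ?size_rot ?cyc_rot.
Qed.

Lemma periodic_rot s j k : (j <= size s)%N ->
  periodic (rot j s) k <-> periodic s k.
Proof.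
move=> js; split=> pk i; last first.
  by rewrite !cyc_rot // addnAC pk.
(* A further shift by [size s - j] completes the rotation to a full turn. *)
have := pk (i + (size s - j))%N; rewrite !cyc_rot //.
have -> : (i + (size s - j) + k + j = i + k + size s)%N by lia.
have -> : (i + (size s - j) + j = i + size s)%N by lia.
by rewrite !periodic_size.
Qed.

Lemma cyc_flatten_nseq r b : (0 < r)%N -> cyc (flatten (nseq r b)) =1 cyc b.
Proof.
move=> r0 i; have szf : size (flatten (nseq r b)) = (r * size b)%N.
  by rewrite size_flatten /shape map_nseq sumn_nseq mulnC.
(* For empty [b] both sides are the default [x0]. *)
have [b0|b0] := posnP (size b).
  by rewrite /cyc !nth_default ?szf ?b0 // muln0.
have nthf j : (j < r * size b)%N -> nth x0 (flatten (nseq r b)) j = cyc b j.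
  clear; elim: r j => [|r IHr] j //= jr; rewrite nth_cat.
  case: ltnP => jb; first by rewrite cyc_small.
  rewrite IHr; last by rewrite mulSn in jr; lia.
  by rewrite -[RHS](cyc_mod _ (periodic_size b)) -{2}(subnK jb) modnDr cyc_mod //;
     exact: periodic_size.
rewrite {1}/cyc szf nthf ?ltn_pmod ?muln_gt0 ?r0 //.
by rewrite /cyc modn_dvdm // dvdn_mull.
Qed.

(* The least positive period divides every period, because periods are closed
   under remainders. *)
Lemma fundamental_period s : (0 < size s)%N ->
  exists2 t, (0 < t)%N & forall k, periodic s k <-> (t %| k)%N.
Proof.
move=> s0.
(* [periodic] quantifies over all indices, so the minimum is taken with a decidable rotation test;
   reducing [k] modulo the size makes the test valid for every [k]. *)
have ex : exists k, (0 < k)%N && (rot (k %% size s) s == s).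
  by exists (size s); rewrite s0 modnn rot0 /=.
have perE k : reflect (periodic s k) (rot (k %% size s) s == s).
  apply: (iffP (rot_periodicP (ltnW (ltn_pmod k s0)))) => [pk|pk].
    rewrite (divn_eq k (size s)); apply: periodicD => //.
    exact/periodicM/periodic_size.
  by apply: periodic_mod => //; apply: periodic_size.
case: (ex_minnP ex) => t /andP[t0 /perE pt] tmin; exists t => // k; split=> [pk|].
  rewrite /dvdn -leqn0 leqNgt; apply/negP => kt.
  have : (t <= k %% t)%N by apply: tmin; rewrite kt; apply/perE/periodic_mod.
  by rewrite leqNgt ltn_pmod.
by case/dvdnP=> q ->; apply: periodicM.
Qed.

(** * Primitive circuits and Möbius inversion *)

(** On the periodic extension the closing bond is a step like any other; hence being a circuit
    depends only on [cyc s]. *)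
Lemma circuitP e s : (0 < size s)%N ->
  reflect (forall i, e (cyc s i) (cyc s i.+1)) (circuit e s).
Proof.
move=> s0; rewrite /circuit s0 /=; case: s s0 => // x p _ /=.
apply: (iffP (pathP x0)) => [h i|h i]; last first.
  rewrite size_rcons ltnS => ip; have := h i.
  rewrite cyc_small //= -rcons_cons nth_rcons /= ltnS ip /cyc.
  rewrite nth_rcons /=; move: ip; rewrite leq_eqVlt => /orP[/eqP->|ip].
    by rewrite modnn ltnn eqxx.
  by rewrite modn_small //= ip.
rewrite -(cyc_mod i (periodic_size (x :: p))).
have -> : cyc (x :: p) i.+1 = cyc (x :: p) (i %% (size p).+1).+1.
  by rewrite /cyc /= -addn1 -modnDml addn1.
have := ltn_pmod i (isT : (0 < (size p).+1)%N); move: (i %% _)%N => j js.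
have := h j; rewrite size_rcons => /(_ js).
rewrite cyc_small //= -rcons_cons nth_rcons /= js /cyc.
rewrite nth_rcons /=; move: js; rewrite ltnS leq_eqVlt => /orP[/eqP->|jp].
  by rewrite modnn ltnn eqxx.
by rewrite modn_small //= jp.
Qed.

Lemma circuit_eq_cyc e s b : (0 < size s)%N -> (0 < size b)%N ->
  cyc s =1 cyc b -> circuit e s = circuit e b.
Proof.
by move=> s0 b0 sb; apply/circuitP/circuitP => // h i; have := h i; rewrite !sb.
Qed.

(** A repetition of [b] has period [size b]. Conversely, a period [k < l] is a multiple of the
    fundamental period [t], and [c] is its first [t] entries repeated [l / t] times. *)
Lemma primitive_periodicP e l (c : l.-tuple V) : circuit e c ->
  reflect (forall k, (0 < k < l)%N -> ~ periodic c k) (primitive_circuit e c).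
Proof.
move=> cc; have l0 : (0 < l)%N by case/andP: (cc); rewrite size_tuple.
apply: (iffP (primitive_circuitP e c)) => [[_ nex] k kl pk|np].
  have [|t t0 tP] := @fundamental_period c; first by rewrite size_tuple.
  apply: nex; exists [seq cyc c i | i <- iota 0 t], (l %/ t)%N.
  have tl : (t %| l)%N by apply/tP; have := periodic_size c; rewrite size_tuple.
  have sb : size [seq cyc c i | i <- iota 0 t] = t by rewrite size_map size_iota.
  have cb : cyc [seq cyc c i | i <- iota 0 t] =1 cyc c.
    move=> i; rewrite /cyc sb (nth_map 0%N) ?size_iota ?ltn_pmod //.
    rewrite nth_iota ?ltn_pmod // add0n -/(cyc _ _) cyc_mod //.
    exact/tP.
  split; last 1 first.
  - apply: cyc_inj => [|i].
      rewrite size_flatten /shape map_nseq sumn_nseq size_map size_iota mulnC.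
      by rewrite divnK // size_tuple.
    by rewrite cyc_flatten_nseq ?divn_gt0 ?(dvdn_leq l0 tl) // cb.
  - by rewrite (circuit_eq_cyc e _ _ cb) // ?sb ?size_tuple.
  - rewrite sb; have /tP := pk; case/andP: kl => k0 kl.
    by move/(dvdn_leq k0)/leq_ltn_trans; apply.
split=> // -[b [r [cb sb ce]]].
have b0 : (0 < size b)%N by case/andP: cb.
apply: (np (size b)); first by rewrite b0 sb.
have r0 : (0 < r)%N.
  by case: r ce => // /(congr1 size); rewrite size_tuple /=; lia.
by move=> i; rewrite ce !cyc_flatten_nseq // periodic_size.
Qed.

(** A circuit fixed by this rotation has period [k], so it has the same periodic extension as its
    first [k] entries; [phi] is the inverse map, repeating a circuit of length [k] up to length
    [l]. *)
Lemma card_rot_fixed_circuits e l k : (0 < l)%N -> (k %| l)%N ->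
  #|[set c : l.-tuple V | circuit e c && (rot k c == c :> seq V)]| =
  #|[set b : k.-tuple V | circuit e b]|.
Proof.
move=> l0 kl; have k0 := dvdn_gt0 l0 kl.
have per (b : k.-tuple V) j : (k %| j)%N -> periodic b j.
  by case/dvdnP=> q ->; apply: periodicM; have := periodic_size b; rewrite size_tuple.
pose phi (b : k.-tuple V) : l.-tuple V := [tuple cyc b i | i < l].
have cphi (b : k.-tuple V) : cyc (phi b) =1 cyc b.
  move=> i; rewrite -[RHS](cyc_mod i (per b l kl)) /cyc size_tuple.
  have il := ltn_pmod i l0.
  by rewrite -[X in nth _ _ X]/(val (Ordinal il)) nth_mktuple.
have phi_inj : injective phi.
  move=> b b' bb'; apply/val_inj/cyc_inj; rewrite /= ?size_tuple // => i.
  by rewrite -!cphi bb'.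
rewrite -(card_imset _ phi_inj); apply: eq_card => c; rewrite inE.
have kc : (k <= size c)%N by rewrite size_tuple dvdn_leq.
apply/andP/imsetP => [[cc /(rot_periodicP kc) pk]|[b cb ->]].
  pose b := [tuple cyc c i | i < k].
  have bc : cyc b =1 cyc c.
    move=> i; rewrite -[RHS](cyc_mod i pk) {1}/cyc size_tuple.
    have ik := ltn_pmod i k0.
    by rewrite -[X in nth _ _ X]/(val (Ordinal ik)) nth_mktuple.
  exists b; first by rewrite inE (circuit_eq_cyc e _ _ bc) ?size_tuple.
  apply/val_inj/cyc_inj; rewrite -?[val _]/(tval _) ?size_tuple // => i.
  by rewrite cphi bc.
rewrite inE in cb; split; first by rewrite (circuit_eq_cyc e _ _ (cphi b)) ?size_tuple.
apply/rot_periodicP => [|i]; first by rewrite size_tuple dvdn_leq.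
by rewrite !cphi (per b).
Qed.

Lemma sum_moebius_rot e l (c : l.-tuple V) : circuit e c ->
  \sum_(w < l.+1 | (w %| l)%N && (rot (l %/ w) c == c :> seq V)) moebius w =
  (primitive_circuit e c)%:R.
Proof.
move=> cc; have l0 : (0 < l)%N by case/andP: (cc); rewrite size_tuple.
have [|t t0 tP] := @fundamental_period c; first by rewrite size_tuple.
have tl : (t %| l)%N by apply/tP; have := periodic_size c; rewrite size_tuple.
rewrite (eq_bigl (fun w : 'I_l.+1 => (w %| l %/ t)%N)) => [|w]; last first.
  have [wl|wl] := boolP (w %| l)%N => /=; last first.
    apply/esym/negbTE; apply: contra wl => /dvdn_trans; apply.
    exact: dvdn_div.
  have w0 := dvdn_gt0 l0 wl.
  (* Both sides say that [w * t] divides [l]. *)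
  have -> : (w %| l %/ t)%N = (t %| l %/ w)%N.
    by rewrite !dvdn_divRL // mulnC.
  have wc : (l %/ w <= size c)%N by rewrite size_tuple leq_div.
  by apply/(rot_periodicP wc)/idP => /tP.
rewrite sum_moebius; last by rewrite divn_gt0 // (dvdn_leq l0 tl) leq_div.
congr (nat_of_bool _)%:R; apply/idP/(primitive_periodicP cc) => [/eqP tl1 k|np].
  case/andP=> k0 kl /tP /(dvdn_leq k0); rewrite leqNgt => /negP [].
  by rewrite -(divnK tl) tl1 mul1n in kl.
have := dvdn_leq l0 tl; rewrite leq_eqVlt => /orP[/eqP->|t_lt].
  by rewrite divnn l0.
by case: (np t); [rewrite t0 | exact/tP].
Qed.

(** Sum [sum_moebius_rot] over all circuits and exchange the sums: each [w] then weighs the circuits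
    fixed by the rotation by [l / w]. *)
Lemma card_primitive_circuits e l : (0 < l)%N ->
  #|[set c : l.-tuple V | primitive_circuit e c]|%:R =
  \sum_(w < l.+1 | (w %| l)%N)
     moebius w * #|[set b : (l %/ w).-tuple V | circuit e b]|%:R.
Proof.
move=> l0.
rewrite -sum1dep_card natr_sum big_mkcond /=.
rewrite (eq_bigr (fun c : l.-tuple V => \sum_(w < l.+1 | (w %| l)%N)
   moebius w * (circuit e c && (rot (l %/ w) c == c :> seq V))%:R)); last first.
  move=> c _; case: (boolP (circuit e c)) => cc /=.
    transitivity ((primitive_circuit e c)%:R : int); first by case: ifP.
    rewrite -sum_moebius_rot // big_mkcondr /=; apply: eq_bigr => w _.
    by case: eqP; rewrite ?mulr1 ?mulr0.
  rewrite big1 ?ifF // => [|w _]; last by rewrite mulr0.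
  by apply/negbTE; apply: contra cc => /andP[].
rewrite exchange_big /=; apply: eq_bigr => w wl.
rewrite -(card_rot_fixed_circuits e l0 (dvdn_div wl)) -mulr_sumr.
rewrite -sum1dep_card natr_sum [in RHS]big_mkcond /=.
by congr (_ * _); apply: eq_bigr => c _; case: ifP.
Qed.

(** * From primitive circuits to primitive orbits *)

Lemma primitive_circuit_rot e l (c c' : l.-tuple V) : rotation_equiv c c' ->
  primitive_circuit e c -> primitive_circuit e c'.
Proof.
case/existsP=> i /eqP cc' pc; have cc : circuit e c by case/andP: pc.
have il : (i <= size c)%N by rewrite size_tuple ltnW.
have cc'' : circuit e c' by rewrite /circuit -cc' size_rot rot_cycle.
apply/(primitive_periodicP cc'') => k kl; rewrite -cc' => /(periodic_rot _ il).
exact: (primitive_periodicP cc pc).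
Qed.

(* The [l] rotations of a primitive circuit of length [l] are distinct. *)
Lemma card_rotation_class e l (c : l.-tuple V) : primitive_circuit e c ->
  #|[set y in [set c' : l.-tuple V | circuit e c'] | rotation_equiv c y]| = l.
Proof.
move=> pc; have cc : circuit e c by case/andP: pc.
pose f (i : 'I_l) : l.-tuple V := [tuple of rot i c].
have f_inj : injective f.
  suff lt_inj (i j : 'I_l) : (i < j)%N -> f i != f j.
    move=> i j /eqP fij; apply/val_inj; case: (ltngtP i j) => // /lt_inj.
      by rewrite fij.
    by rewrite eq_sym fij.
  move=> ij; apply/eqP => /(congr1 val) /= fij.
  apply: (elimT (primitive_periodicP cc) pc (j - i)%N).
    by rewrite subn_gt0 ij /=; have := ltn_ord j; lia.
  have il : (i <= size c)%N by rewrite size_tuple ltnW.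
  have jl : (j <= size c)%N by rewrite size_tuple ltnW.
  (* Equal rotations by [i < j] make [j - i] a period of [rot i c], hence of [c]. *)
  apply/(periodic_rot _ il) => x; rewrite cyc_rot // -addnA subnK ?(ltnW ij) //.
  by rewrite -cyc_rot // fij.
rewrite -[RHS]card_ord -(card_imset _ f_inj); apply: eq_card => y.
rewrite !inE; apply/andP/imsetP => [[_ /existsP[i /eqP iy]]|[i _ ->]].
  by exists i => //; apply/val_inj; rewrite /= iy.
split; first by rewrite /circuit /= size_rot rot_cycle.
by apply/existsP; exists i.
Qed.

(** The primitive orbits partition the primitive circuits into classes of [l] elements each. *)
Lemma card_primitive_orbits e l :
  #|[set c : l.-tuple V | primitive_circuit e c]| =
  (#|primitive_periodic_orbits e l| * l)%N.
Proof.
set D := [set c : l.-tuple V | circuit e c].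
have part : partition (periodic_orbits e l) D.
  exact/equivalence_partitionP/rotation_equivP.
have sub : primitive_periodic_orbits e l \subset periodic_orbits e l.
  by apply/subsetP => O; rewrite inE => /andP[].
have refl (c : l.-tuple V) : circuit e c -> rotation_equiv c c.
  move=> cc; have cD : c \in D by rewrite inE.
  by have [] := rotation_equivP cD cD cD.
have primO (c : l.-tuple V) : primitive_circuit e c ->
    [set y in D | rotation_equiv c y] \in primitive_periodic_orbits e l.
  move=> pc; rewrite inE; apply/andP; split.
    by apply: imset_f; rewrite inE; case/andP: pc.
  apply/forallP => y; apply/implyP; rewrite !inE => /andP[_ cy].
  exact: primitive_circuit_rot cy pc.
apply: card_uniform_partition => [O|].
  rewrite inE => /andP[/imsetP[c cD ->] /forallP/(_ c)].
  have cc : circuit e c by rewrite inE in cD.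
  by rewrite !inE cc refl //=; apply: card_rotation_class.
case/and3P: part => /eqP covD triv n0; apply/and3P; split.
- rewrite eqEsubset; apply/andP; split; apply/subsetP => c; rewrite inE.
    case/bigcupP=> O; rewrite inE => /andP[_ /forallP/(_ c)/implyP h] /h.
    by [].
  move=> pc; apply/bigcupP; exists [set y in D | rotation_equiv c y].
    exact: primO.
  by case/andP: (pc) => cc _; rewrite !inE cc refl.
- exact: trivIsetS sub triv.
- by apply: contra n0; apply: (subsetP sub).
Qed.

End Cyclic.

(** * Counting circuits of the circulant graph *)

Lemma big_tuple_cons (T : finType) (k : nat) (F : k.+1.-tuple T -> nat) :
  (\sum_t F t = \sum_x \sum_(s : k.-tuple T) F [tuple of x :: s])%N.
Proof.
rewrite pair_big /= (reindex (fun p : T * k.-tuple T => [tuple of p.1 :: p.2])) //.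
exists (fun t : k.+1.-tuple T => (thead t, [tuple of behead t])) => [[x s] _|t _] /=.
  by congr pair; apply/val_inj.
by rewrite -tuple_eta.
Qed.

(** Pascal's rule in the form needed to split walks by their first step: a short step keeps the
    number [j] of long steps, a long one raises it by 1. *)
Lemma sum_binS (m : nat) (X : nat -> nat) :
  (\sum_(j < m.+2) 'C(m.+1, j) * X j =
   \sum_(j < m.+1) 'C(m, j) * X j + \sum_(j < m.+1) 'C(m, j) * X j.+1)%N.
Proof.
rewrite big_ord_recl /= bin0 mul1n.
under eq_bigr => j _ do rewrite /bump /= add1n binS mulnDl.
rewrite big_split /= addnA; congr addn; symmetry.
(* The extra last term is 0, since ['C(m, m.+1)] is. *)
transitivity (\sum_(j < m.+2) 'C(m, j) * X j)%N.
  by rewrite [RHS]big_ord_recr /= bin_small ?mul0n ?addn0.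
by rewrite big_ord_recl /= bin0 mul1n; congr addn; apply: eq_bigr.
Qed.

Section Circulant.
Local Open Scope nat_scope.
Variables (n a d : nat).
Hypotheses (d_gt0 : (0 < d)%N) (d_lt : (d < n)%N).

Let e := @circulant_bond n a d.

(** Since [0 < d < n], the two bonds leaving [v] have different ends, so the disjunction in
    [circulant_bond] never merges them. *)
Lemma sum_circulant_bond (v : 'I_n) (F : nat -> nat) :
  \sum_w e v w * F w = F ((v + a) %% n) + F ((v + a + d) %% n).
Proof.
have n0 : 0 < n := leq_ltn_trans (leq0n d) d_lt.
pose w1 : 'I_n := Ordinal (ltn_pmod (v + a) n0).
pose w2 : 'I_n := Ordinal (ltn_pmod (v + a + d) n0).
have w21 : w2 != w1.
  apply/eqP => /(congr1 val) /= /eqP.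
  rewrite -{2}(addn0 (v + a)) eqn_modDl mod0n modn_small //; lia.
rewrite (bigD1 w1) // (bigD1 w2) //= big1 => [|w /andP[w_1 w_2]].
  by rewrite /e /circulant_bond /= !eqxx orbT !mul1n addn0.
by rewrite /e /circulant_bond -[(_ + a) %% n]/(val w1) -[(_ + d) %% n]/(val w2)
  !(inj_eq val_inj) (negPf w_1) (negPf w_2).
Qed.

(** Here [j] is the number of long steps among the [k.+1] steps from [v] to [u]. The induction
    removes the first step and recombines the two cases by [sum_binS]. *)
Lemma count_circulant_paths (k : nat) (v u : 'I_n) :
  (\sum_(s : k.-tuple 'I_n) path e v (rcons s u) =
   \sum_(j < k.+2) 'C(k.+1, j) * (u == v + a * k.+1 + d * j %[mod n]))%N.
Proof.
elim: k v => [|k IHk] v.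
  rewrite (eq_bigr (fun=> e v u : nat)) => [|s _]; last first.
    by rewrite (tuple0 s) /= andbT.
  rewrite big_const card_tuple expn0 /= addn0 !big_ord_recl big_ord0 /=.
  rewrite bin0 binn !mul1n muln0 !muln1 !addn0 /e /circulant_bond.
  rewrite /bump /= (modn_small (ltn_ord u)).
  case: eqP => [->|]; case: eqP => //= /eqP.
  by rewrite -{1}(addn0 (v + a)) eqn_modDl mod0n eq_sym modn_small //; lia.
rewrite big_tuple_cons.
(* [G] is defined on [nat] so that it can be evaluated at the residues in [sum_circulant_bond]. *)
pose G (w : nat) := (\sum_(j < k.+2)
   'C(k.+1, j) * (u == w + a * k.+1 + d * j %[mod n]))%N.
transitivity (\sum_w e v w * G w)%N.
  apply: eq_bigr => w _; rewrite /G -IHk big_distrr /=; apply: eq_bigr => s _.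
  by rewrite mulnb.
rewrite sum_circulant_bond {}/G.
have modE (x j : nat) :
    (x %% n + a * k.+1 + d * j)%N = (x + a * k.+1 + d * j)%N %[mod n].
  by rewrite -!addnA modnDml.
rewrite (sum_binS k.+1 (fun j => u == v + a * k.+2 + d * j %[mod n] : nat)).
congr addn; apply: eq_bigr => j _; rewrite modE.
  by congr (_ * (_ == _ %% n)); lia.
by congr (_ * (_ == _ %% n)); lia.
Qed.

(** When a walk returns to its start, the start cancels from the congruence, so each of the [n]
    vertices contributes the same sum. *)
Lemma card_circulant_circuits (k : nat) : (0 < k) ->
  #|[set c : k.-tuple 'I_n | circuit e c]| =
  n * \sum_(j < k.+1) 'C(k, j) * (n %| a * k + d * j).
Proof.
case: k => // k _; rewrite -sum1dep_card big_mkcond big_tuple_cons.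
transitivity (\sum_(v : 'I_n) \sum_(j < k.+2) 'C(k.+1, j) * (n %| a * k.+1 + d * j)).
  apply: eq_bigr => v _.
  transitivity (\sum_(s : k.-tuple 'I_n) path e v (rcons s v)).
    by apply: eq_bigr => s _; rewrite /circuit /=; case: ifP.
  rewrite count_circulant_paths; apply: eq_bigr => j _; congr (_ * nat_of_bool _).
  by rewrite -{1}(addn0 v) -addnA eqn_modDl mod0n eq_sym.
by rewrite sum_nat_const card_ord.
Qed.

End Circulant.

(** * Matching the binomial sum over [m] *)

(** The sum detects whether the rational lower index equals some natural [j] with [j <= l / w]. If
    it is negative, fractional or too large, both sides are 0. *)
Lemma binomial_ratE (a d n l w m : nat) : (0 < d)%N -> (0 < w)%N -> (w %| l)%N ->
  binomial_rat (l%:R / w%:R) ((m%:R * n%:R - a%:R * l%:R) / (w%:R * d%:R)) =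
  (\sum_(j < (l %/ w).+1)
     'C(l %/ w, j) * (m * n == w * (a * (l %/ w) + d * j)))%N.
Proof.
move=> d0 w0 /dvdnP[k ->]; rewrite mulnK //.
have w_neq0 : w%:R != 0 :> rat by rewrite pnatr_eq0 -lt0n.
have d_neq0 : d%:R != 0 :> rat by rewrite pnatr_eq0 -lt0n.
have wd_neq0 : w%:R * d%:R != 0 :> rat by rewrite mulf_neq0.
rewrite natrM mulfK //; set q := _ / _.
have qE (j : nat) : (q == j%:R) = (m * n == w * (a * k + d * j))%N.
  rewrite -(inj_eq (mulIf wd_neq0)) divfK // subr_eq -!natrM -natrD eqr_nat.
  by congr eq_op; lia.
rewrite /binomial_rat natr_nat /= natrK.
case: ifP => [/natrP[j qj]|qN].
  rewrite qj natrK; have [jk|jk] := ltnP j k.+1; last first.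
    rewrite bin_small // big1 // => i _; rewrite -qE qj eqr_nat.
    by rewrite gtn_eqF ?muln0 // (leq_trans (ltn_ord i)).
  rewrite (bigD1 (Ordinal jk)) //= big1 => [|i ij]; rewrite -qE qj eqr_nat.
    by rewrite eqxx muln1 addn0.
  by rewrite eq_sym -[j]/(val (Ordinal jk)) (inj_eq val_inj) (negPf ij) muln0.
rewrite big1 // => j _; rewrite -qE; case: eqP => [qj|_]; last by rewrite muln0.
by rewrite qj natr_nat in qN.
Qed.

(** The bounds on [m] are integers read as naturals through the absolute value, which is faithful
    because they are nonnegative. *)
Lemma leq_abs_ceil (p n m : nat) : (0 < n)%N ->
  (`|Num.ceil (p%:R / n%:R : rat)| <= m)%N = (p <= m * n)%N.
Proof.
move=> n0; have n0' : 0 < n%:R :> rat by rewrite ltr0n.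
rewrite -lez_nat gez0_abs; last first.
  by rewrite ceil_ge0 (lt_le_trans (ltrN10 _)) // divr_ge0.
by rewrite ceil_le_int -pmulrn ler_pdivrMr // -natrM ler_nat.
Qed.

Lemma geq_abs_floor (p n m : nat) : (0 < n)%N ->
  (m <= `|Num.floor (p%:R / n%:R : rat)|)%N = (m * n <= p)%N.
Proof.
move=> n0; have n0' : 0 < n%:R :> rat by rewrite ltr0n.
rewrite -lez_nat gez0_abs; last by rewrite floor_ge0 divr_ge0.
by rewrite floor_ge_int -pmulrn ler_pdivlMr // -natrM ler_nat.
Qed.

(** For fixed [j], at most one [m] satisfies [m * n = w * (a * (l / w) + d * j)]. A solution
    divisible by [w] exists iff [n] divides the bracket, and then it is [w] times the quotient. *)
Lemma sum_binomial_rat (a d n l w : nat) :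
    (0 < d)%N -> (0 < n)%N -> (0 < w)%N -> (w %| l)%N ->
  (\sum_(`|Num.ceil ((a * l)%N%:R / n%:R : rat)|%N <= m
          < (`|Num.floor (((d + a) * l)%N%:R / n%:R : rat)|%N).+1 | w %| m)
     binomial_rat (l%:R / w%:R) ((m%:R * n%:R - a%:R * l%:R) / (w%:R * d%:R)) =
   \sum_(j < (l %/ w).+1) 'C(l %/ w, j) * (n %| a * (l %/ w) + d * j))%N.
Proof.
move=> d0 n0 w0 wl.
under eq_bigr => m _ do rewrite binomial_ratE //.
rewrite exchange_big /=; apply: eq_bigr => j _; rewrite -big_distrr /=.
congr muln; have jk : (j <= l %/ w)%N by rewrite -ltnS.
have lE : l = (l %/ w * w)%N by rewrite divnK.
move: (nat_of_ord j) jk => {}j; move: (l %/ w)%N lE => k lE jk.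
have [/dvdnP[q qn]|nX] := boolP (n %| a * k + d * j)%N; last first.
  rewrite big1 // => m /dvdnP[q ->]; apply/eqP; rewrite eqb0.
  apply: contra nX => /eqP; rewrite mulnAC [RHS]mulnC => /eqP.
  by rewrite eqn_pmul2r // => /eqP <-; rewrite dvdn_mull.
rewrite -big_filter (bigD1_seq (q * w)%N) /=; last first.
- by rewrite filter_uniq ?iota_uniq.
(* The solution is in range: as [0 <= j <= l / w], its product with [n] lies between [a * l] and
   [(d + a) * l]. *)
- rewrite mem_filter dvdn_mull //= mem_index_iota ltnS.
  rewrite leq_abs_ceil // geq_abs_floor // mulnAC -qn lE !mulnA !leq_pmul2r //.
  by rewrite leq_addr mulnDl addnC leq_add2r leq_mul2l jk orbT.
rewrite qn big1 => [|m mq]; first by rewrite (_ : _ == _) //; apply/eqP; lia.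
apply/eqP; rewrite eqb0; apply: contra mq => /eqP mqw; apply/eqP.
by apply/eqP; rewrite -(eqn_pmul2r n0) mqw; apply/eqP; lia.
Qed.

(** * Assembling the formula *)

Unset Implicit Arguments.

Theorem theorem1 (a1 d n l : nat) (a1_gt0 : (0 < a1)%N) (d_gt0 : (0 < d)%N)
    (n_gt : (a1 + d < n)%N) (l_gt0 : (0 < l)%N) :
  #|primitive_periodic_orbits (@circulant_bond n a1 d) l|%:R =
    n%:R / l%:R *
    (\sum_(`|Num.ceil ((a1 * l)%N%:R / n%:R : rat)|%N <= m
            < (`|Num.floor (((d + a1) * l)%N%:R / n%:R : rat)|%N).+1)
      \sum_(1 <= w < l.+1 | (w %| m)%N && (w %| l)%N)
        (moebius w)%:~R *
        (binomial_rat (l%:R / w%:R)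
           ((m%:R * n%:R - a1%:R * l%:R) / (w%:R * d%:R)))%:R) :> rat.
Proof.
have n0 : (0 < n)%N by lia.
have d_lt : (d < n)%N by lia.
have l_neq0 : l%:R != 0 :> rat by rewrite pnatr_eq0 -lt0n.
apply: (mulIf l_neq0); rewrite mulrAC divfK // -[LHS]natrM -card_primitive_orbits;
  last exact: Ordinal n0.
(* Vertex 0 serves as the default entry of [cyc]. *)
rewrite [LHS]pmulrn -natz (card_primitive_circuits (Ordinal n0)) //.
rewrite (exchange_big_dep (fun w => w %| l)%N) /=; last by move=> m w _ /andP[].
rewrite rmorph_sum mulr_sumr -(big_mkord (fun w => w %| l)%N
  (fun w => (moebius w * #|[set b : (l %/ w).-tuple 'I_n |
     circuit (@circulant_bond n a1 d) b]|%:R)%:~R)) /=.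
(* The sum over divisors starts at [w = 0], which does not divide [l], while the target starts at
   1. *)
rewrite big_ltn_cond // dvd0n (gtn_eqF l_gt0) [LHS]big_seq_cond [RHS]big_seq_cond.
apply: eq_bigr => w; rewrite mem_index_iota => /andP[/andP[w0 _] wl].
rewrite -mulr_sumr (eq_bigl (fun m => w %| m)%N) => [|m]; last by rewrite wl andbT.
rewrite -natr_sum sum_binomial_rat // card_circulant_circuits //; last first.
  by rewrite divn_gt0 // dvdn_leq.
by rewrite rmorphM /= natrM rmorphM /= !rmorph_nat mulrCA.
Qed.
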